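(* Let $X$ be a simply connected rationally elliptic space with $P_X(t)\neq 1$, let $\varepsilon>0$, and let $r(t)$ be the implicit function defined by the equation $$r(t)P^{\pi}_X(t)=\left(P_X(t)\right)^{r(t)}\quad (t\ge\varepsilon),$$ where, if for a given $t$ there are two solutions, $r(t)$ is the larger one, and $r(t)$ is not defined if there is no solution. Then $r(t)$ is expressed in terms of the Lambert $W$-function $W(z)$ by $$r(t)=-\frac{1}{\log P_X(t)}\,W\!\left(-\frac{\log P_X(t)}{P^{\pi}_X(t)}\right).$$
   Context: A rationally elliptic space is a simply connected topological space $X$ with $\dim(\pi_*(X)\otimes\mathbb{Q})<\infty$ and $\dim H_*(X;\mathbb{Q})<\infty$, where $\pi_*(X)\otimes\mathbb{Q}=\bigoplus_{i\ge 2}\pi_i(X)\otimes\mathbb{Q}$ and $H_*(X;\mathbb{Q})=\bigoplus_{i\ge 0}H_i(X;\mathbb{Q})$. Its homological and homotopical Poincaré polynomials are $P_X(t)=\sum_{k\ge 0}\dim H_k(X;\mathbb{Q})\,t^k$ and $P^{\pi}_X(t)=\sum_{k\ge 2}\dim(\pi_k(X)\otimes\mathbb{Q})\,t^k$. The Lambert $W$-function $W(z)$ is defined as the inverse function of the transcendental function $z=we^w$, i.e. $z=W(z)e^{W(z)}$. *)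

(* Defs.v *)
From HB Require Import structures.
From mathcomp Require Import all_boot all_order all_algebra.
From mathcomp Require Import all_classical all_reals all_analysis.
From mathcomp Require Import freeg.

Set Implicit Arguments.
Unset Strict Implicit.
Unset Printing Implicit Defensive.

Import Order.TTheory GRing.Theory Num.Theory.
Import numFieldNormedType.Exports.

Local Open Scope classical_set_scope.
Local Open Scope ring_scope.

Section LinearAlgebra.
Context {F : fieldType}.

Definition is_basis (V : lmodType F) (n : nat) (b : 'I_n -> V) : Prop :=
  (forall v : V, exists a : 'I_n -> F, v = \sum_i a i *: b i) /\
  (forall a : 'I_n -> F, \sum_i a i *: b i = 0 -> forall i, a i = 0).

Definition finite_dim (V : lmodType F) : Prop :=
  exists (n : nat) (b : 'I_n -> V), is_basis b.

(* Equal to 0 by convention when [V] is infinite-dimensional. *)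
Definition dim (V : lmodType F) : nat :=
  xget 0%N [set n | exists b : 'I_n -> V, is_basis b].

Definition span_of (V : lmodType F) (A : set V) : {pred V} :=
  [pred v | `[< forall U : {pred V}, submod_closed U ->
                  (forall u, A u -> u \in U) -> v \in U >]].

Lemma span_of_submod (V : lmodType F) (A : set V) : submod_closed (span_of A).
Proof.
split; first by apply/asboolP => U [].
move=> a u v /asboolP uA /asboolP vA; apply/asboolP => U Umod AU.
by case: (Umod) => _; apply; [exact: uA|exact: vA].
Qed.

HB.instance Definition _ (V : lmodType F) (A : set V) :=
  GRing.isSubmodClosed.Build F V (span_of A) (span_of_submod A).

End LinearAlgebra.

Section QuotientModule.
Local Open Scope quotient_scope.
Context {F : fieldType} (V : lmodType F) (A : set V).

(* The quotient of [V] by the subspace spanned by [A]. *)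
Definition quotmod : Type := ring_quotient.Quotient.quot (span_of A).

HB.instance Definition _ := GRing.Zmodule.on quotmod.

Definition quotmod_pi (v : V) : quotmod :=
  \pi_(ring_quotient.Quotient.quot (span_of A)) v.

Definition quotmod_scale (a : F) (x : quotmod) : quotmod :=
  quotmod_pi (a *: repr (x : ring_quotient.Quotient.quot (span_of A))).

Let piP (u v : V) : quotmod_pi u = quotmod_pi v <-> u - v \in span_of A.
Proof.
rewrite ring_quotient.Quotient.idealrBE.
by split=> [/eqP|/eqP].
Qed.

Let piD (u v : V) : quotmod_pi (u + v) = quotmod_pi u + quotmod_pi v.
Proof. exact: raddfD. Qed.

Let piZ (a : F) (v : V) : quotmod_scale a (quotmod_pi v) = quotmod_pi (a *: v).
Proof.
apply/piP; rewrite -scalerBr rpredZ//; apply/piP.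
exact: reprK.
Qed.

Let pi_surj (x : quotmod) : exists v, x = quotmod_pi v.
Proof.
by exists (repr (x : ring_quotient.Quotient.quot (span_of A)));
  rewrite /quotmod_pi reprK.
Qed.

Let scaleA a b x :
  quotmod_scale a (quotmod_scale b x) = quotmod_scale (a * b) x.
Proof. by have [v ->] := pi_surj x; rewrite !piZ scalerA. Qed.

Let scale1 : left_id 1 quotmod_scale.
Proof. by move=> x; have [v ->] := pi_surj x; rewrite piZ scale1r. Qed.

Let scaleDr : right_distributive quotmod_scale +%R.
Proof.
move=> a x y; have [u ->] := pi_surj x; have [v ->] := pi_surj y.
by rewrite -piD !piZ -piD scalerDr.
Qed.

Let scaleDl x : {morph quotmod_scale^~ x : a b / a + b}.
Proof.
by move=> a b; have [v ->] := pi_surj x; rewrite !piZ -piD scalerDl.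
Qed.

HB.instance Definition _ := GRing.Zmodule_isLmodule.Build F quotmod
  scaleA scale1 scaleDr scaleDl.

End QuotientModule.

Section DirectSum.
Context {F : fieldType} (V : nat -> lmodType F).

Definition dprod : Type := forall i, V i.

HB.instance Definition _ := Choice.on dprod.

Let padd (u v : dprod) : dprod := fun i => u i + v i.
Let popp (u : dprod) : dprod := fun i => - u i.
Let pzero : dprod := fun i => 0.
Let pscale (a : F) (u : dprod) : dprod := fun i => a *: u i.

Let paddA : associative padd.
Proof. by move=> u v w; apply/functional_extensionality_dep => i; exact: addrA. Qed.
Let paddC : commutative padd.
Proof. by move=> u v; apply/functional_extensionality_dep => i; exact: addrC. Qed.
Let padd0 : left_id pzero padd.
Proof. by move=> u; apply/functional_extensionality_dep => i; exact: add0r. Qed.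
Let paddN : left_inverse pzero popp padd.
Proof. by move=> u; apply/functional_extensionality_dep => i; exact: addNr. Qed.

HB.instance Definition _ :=
  GRing.isZmodule.Build dprod paddA paddC padd0 paddN.

Let pscaleA a b u : pscale a (pscale b u) = pscale (a * b) u.
Proof. by apply/functional_extensionality_dep => i; exact: scalerA. Qed.
Let pscale1 : left_id 1 pscale.
Proof. by move=> u; apply/functional_extensionality_dep => i; exact: scale1r. Qed.
Let pscaleDr : right_distributive pscale +%R.
Proof. by move=> a u v; apply/functional_extensionality_dep => i; exact: scalerDr. Qed.
Let pscaleDl u : {morph pscale^~ u : a b / a + b}.
Proof. by move=> a b; apply/functional_extensionality_dep => i; exact: scalerDl. Qed.

HB.instance Definition _ := GRing.Zmodule_isLmodule.Build F dprod
  pscaleA pscale1 pscaleDr pscaleDl.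

Definition fin_supp : {pred dprod} :=
  [pred u | `[< exists N, forall i, (N <= i)%N -> u i = 0 >]].

Lemma fin_supp_submod : submod_closed fin_supp.
Proof.
split; first by apply/asboolP; exists 0%N.
move=> a u v /asboolP[N uN] /asboolP[M vM]; apply/asboolP.
exists (maxn N M) => i; rewrite geq_max => /andP[Ni Mi].
have -> : (a *: u + v) i = a *: u i + v i by [].
by rewrite uN// vM// scaler0 addr0.
Qed.

HB.instance Definition _ :=
  GRing.isSubmodClosed.Build F dprod fin_supp fin_supp_submod.

Record dsum : Type := DSum { dsum_val : dprod; _ : dsum_val \in fin_supp }.

HB.instance Definition _ := [isSub for dsum_val].
HB.instance Definition _ := [Choice of dsum by <:].
HB.instance Definition _ := [SubChoice_isSubLmodule of dsum by <:].

End DirectSum.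

(* [G (x) Q] for an abelian group [(G, op)]: the extension of scalars of [G],
   i.e. the rational vector space generated by the symbols [x (x) 1] subject to
   additivity in [x]. *)
Definition tensorQ (G : choiceType) (op : G -> G -> G) : lmodType rat :=
  @quotmod rat {freeg G / rat}
    [set v | exists x y : G, v = << op x y >> - << x >> - << y >>].

Section FreeModuleLift.
Context (K : choiceType) (M : lmodType rat) (f : K -> M).

HB.instance Definition _ :=
  GRing.isZmodMorphism.Build {freeg K / rat} M (fglift f) (lift_is_additive f).

Lemma fglift_is_scalable : scalable (fglift f).
Proof.
move=> a D; rewrite -[in LHS](freeg_sumE D) -[in RHS](freeg_sumE D).
rewrite scaler_sumr 2!raddf_sum [RHS]scaler_sumr /=; apply: eq_bigr => k _.
have -> : a *: << coeff k D *g k >> = << (a * coeff k D) *g k >> :> {freeg K / rat}.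
  by apply/eqP/freeg_eqP => x; rewrite coeffZ !coeffU mulrA.
by rewrite !liftU scalerA.
Qed.

HB.instance Definition _ := GRing.isScalable.Build rat {freeg K / rat} M *:%R
  (fglift f) fglift_is_scalable.

End FreeModuleLift.

Section Simplices.
Context (R : realType).

Definition simplex (n : nat) : set 'rV[R]_n.+1 :=
  [set x | (forall i, 0 <= x 0 i) /\ \sum_i x 0 i = 1].
Arguments simplex : clear implicits.

(* The [i]-th face inclusion inserts a zero barycentric coordinate at [i]. *)
Definition insert0 (n : nat) (i : 'I_n.+2) (x : 'rV[R]_n.+1) : 'rV[R]_n.+2 :=
  \row_j (if unlift i j is Some k then x 0 k else 0).

Lemma insert0_simplex n i x : simplex n x -> simplex n.+1 (insert0 i x).
Proof.
move=> [x0 x1]; split=> [j|]; first by rewrite mxE; case: unlift.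
rewrite (bigD1_ord i)//= mxE unlift_none add0r -x1.
by apply: eq_bigr => k _; rewrite mxE liftK.
Qed.

Lemma row_continuous (T : topologicalType) (n : nat) (f : T -> 'rV[R]_n) :
  (forall j, continuous (fun x => f x 0 j)) -> continuous f.
Proof.
move=> fc x A [P Pn PA]; rewrite nbhs_simpl /=.
have : \forall y \near x, forall j, P 0 j (f y 0 j).
  by apply: filter_forall => j; exact: (fc j x _ (Pn 0 j)).
apply: filterS => y Py; apply: PA => i j; rewrite (ord1 i); exact: Py.
Qed.

Lemma insert0_continuous n i : continuous (@insert0 n i).
Proof.
apply: row_continuous => j.
under eq_fun do rewrite mxE.
case: unlift => [k|]; [exact: coord_continuous|exact: cst_continuous].
Qed.

Definition face_fun (n : nat) (i : 'I_n.+2) (x : simplex n) : simplex n.+1 :=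
  SigSub (mem_set (insert0_simplex i (set_valP x))).

Lemma face_continuous n i : continuous (@face_fun n i).
Proof.
apply: continuous_comp_initial => x.
apply: (@continuous_comp _ _ _ set_val (@insert0 n i)).
  exact: initial_continuous.
exact: insert0_continuous.
Qed.

Definition face (n : nat) (i : 'I_n.+2) :
  continuousType (simplex n) (simplex n.+1) := mkcts (@face_continuous n i).

End Simplices.

Arguments simplex : clear implicits.

Section SingularHomology.
Context (R : realType) (X : topologicalType).

Definition chain (n : nat) : lmodType rat :=
  {freeg (continuousType (simplex R n) X) / rat}.

Definition boundary_simplex (n : nat)
    (s : continuousType (simplex R n.+1) X) : chain n :=
  \sum_(i < n.+2) (-1) ^+ i *:
    << (s \o face R i : continuousType (simplex R n) X) >>.

Definition boundary (n : nat) : chain n -> chain n.-1 :=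
  match n with
  | 0 => fun=> 0
  | m.+1 => fglift (@boundary_simplex m)
  end.

Definition cycles (n : nat) : {pred chain n} := [pred c | boundary c == 0].

Lemma boundary_linear n a (c d : chain n) :
  boundary (a *: c + d) = a *: boundary c + boundary d.
Proof.
case: n c d => [|n] c d; first by rewrite /= scaler0 addr0.
by rewrite /= linearP.
Qed.

Lemma cycles_submod n : submod_closed (@cycles n).
Proof.
split; first by rewrite inE; case: n => [|n] /=; rewrite ?raddf0 eqxx.
move=> a c d; rewrite !inE => /eqP c0 /eqP d0.
by rewrite boundary_linear c0 d0 scaler0 addr0.
Qed.

HB.instance Definition _ n :=
  GRing.isSubmodClosed.Build rat (chain n) (@cycles n) (cycles_submod n).

Record cycle (n : nat) : Type :=
  Cycle { cycle_val : chain n; _ : cycle_val \in @cycles n }.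

HB.instance Definition _ n := [isSub for @cycle_val n].
HB.instance Definition _ n := [Choice of cycle n by <:].
HB.instance Definition _ n := [SubChoice_isSubLmodule of cycle n by <:].

(* [H_n(X; Q)] *)
Definition homology (n : nat) : lmodType rat :=
  @quotmod rat (cycle n)
    [set z | exists c : chain n.+1, cycle_val z = boundary c].

End SingularHomology.

Section HomotopyGroups.
Context (R : realType) (X : topologicalType) (x0 : X).

Definition cube (n : nat) : set 'rV[R]_n :=
  [set x | forall i, 0 <= x 0 i <= 1].
Arguments cube : clear implicits.

Definition cube_boundary (n : nat) : set 'rV[R]_n :=
  [set x | cube n x /\ exists i, x 0 i = 0 \/ x 0 i = 1].

(* Maps [(I^n, dI^n) -> (X, x0)]; the values outside the cube are irrelevant,
   since [homotopic] below only looks at the cube. *)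
Record spheroid (n : nat) : Type := Spheroid {
  spheroid_fun :> 'rV[R]_n -> X;
  spheroid_continuous : {within cube n, continuous spheroid_fun};
  spheroid_boundary : forall x, cube_boundary x -> spheroid_fun x = x0
}.

Definition homotopic (n : nat) (f g : spheroid n) : Prop :=
  exists H : R * 'rV[R]_n -> X,
    [/\ {within `[0, 1] `*` cube n, continuous H},
        forall x, cube n x -> H (0, x) = f x,
        forall x, cube n x -> H (1, x) = g x &
        forall t x, 0 <= t <= 1 -> cube_boundary x -> H (t, x) = x0].

Definition homotopy_class (n : nat) (f : spheroid n) : set (spheroid n) :=
  [set g | homotopic f g].

Definition pi_ (n : nat) : Type := set_type (range (@homotopy_class n)).

HB.instance Definition _ n := Choice.on (pi_ n).

Definition class_of (n : nat) (f : spheroid n) : pi_ n :=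
  SigSub (mem_set (imageT (@homotopy_class n) f)).

Definition representative (n : nat) (a : pi_ n) : spheroid n :=
  projT1 (cid2 (set_valP a)).

Definition stretch (n : nat) (a : R) (x : 'rV[R]_n.+1) : 'rV[R]_n.+1 :=
  \row_j (if j == 0 then 2 * x 0 j - a else x 0 j).

Definition concat_fun (n : nat) (f g : 'rV[R]_n.+1 -> X) (x : 'rV[R]_n.+1) : X :=
  if x 0 0 <= 2^-1 then f (stretch 0 x) else g (stretch 1 x).

Lemma stretch_continuous n a : continuous (@stretch n a).
Proof.
apply: row_continuous => j; have [j0|j0] := boolP (j == 0).
  have -> : (fun x => stretch a x 0 j) = (fun x => 2 * x 0 j - a).
    by apply/funext => x; rewrite mxE j0.
  move=> x; apply: (@continuous_comp _ _ _ (fun x : 'rV[R]_n.+1 => x 0 j)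
    (fun y : R => 2 * y - a)); first exact: coord_continuous.
  by apply: cvgB; [apply: cvgM; [exact: cvg_cst|exact: cvg_id]|exact: cvg_cst].
have -> : (fun x => stretch a x 0 j) = (fun x => x 0 j).
  by apply/funext => x; rewrite mxE (negbTE j0).
exact: coord_continuous.
Qed.

Lemma within_comp_cont (T U : topologicalType) (A : set T) (B : set U)
    (h : T -> U) (f : U -> X) : (forall x, A x -> B (h x)) -> continuous h ->
  {within B, continuous f} -> {within A, continuous (f \o h)}.
Proof.
move=> AB hc /subspace_continuousP fc; apply/subspace_continuousP => x Ax.
move=> W /(fc _ (AB _ Ax)); rewrite !nbhs_simpl /= => BW.
have := hc x _ BW; rewrite nbhs_simpl /=; apply: filterS => y /= + Ay.
by apply; exact: AB.
Qed.

Lemma stretch_cube n (a : R) (x : 'rV[R]_n.+1) : cube n.+1 x ->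
  0 <= 2 * x 0 0 - a <= 1 -> cube n.+1 (stretch a x).
Proof.
move=> cx x01 i; rewrite mxE; case: eqP => [->//|_]; exact: cx.
Qed.

Lemma concat_mid n (f g : spheroid n.+1) (x : 'rV[R]_n.+1) :
  cube n.+1 x -> x 0 0 = 2^-1 -> f (stretch 0 x) = g (stretch 1 x).
Proof.
move=> cx x2.
rewrite (spheroid_boundary f) ?(spheroid_boundary g)//; split.
- by apply: stretch_cube => //; rewrite x2 mulfV ?subrr ?lexx ?ler01.
- by exists 0; left; rewrite mxE eqxx x2 mulfV ?subrr.
- by apply: stretch_cube => //; rewrite x2 mulfV ?subr0 ?lexx ?ler01.
- by exists 0; right; rewrite mxE eqxx x2 mulfV ?subr0.
Qed.

Lemma closed_cube n : closed (cube n).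
Proof.
have -> : cube n = \bigcap_(i in [set: 'I_n])
    ((fun x : 'rV[R]_n => x 0 i) @^-1` `[0, 1]%classic).
  apply/seteqP; split => x cx i; last by have := cx i I; rewrite /= in_itv.
  by move=> _; rewrite /= in_itv /=; exact: cx.
apply: closed_bigI => i _; apply: preimage_closed; last exact: itv_closed.
by move=> x _; exact: coord_continuous.
Qed.

Lemma concat_continuous n (f g : spheroid n.+1) :
  {within cube n.+1, continuous (concat_fun f g)}.
Proof.
pose p (x : 'rV[R]_n.+1) := x 0 0.
pose A : set 'rV[R]_n.+1 := cube n.+1 `&` p @^-1` [set y | y <= 2^-1].
pose B : set 'rV[R]_n.+1 := cube n.+1 `&` p @^-1` [set y | 2^-1 <= y].
have pc : continuous p by exact: coord_continuous.
have cubeAB : cube n.+1 = A `|` B.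
  rewrite /A /B -setIUr setIidl// => x _ /=.
  by case: (leP (p x) 2^-1) => [|/ltW]; [left|right].
rewrite cubeAB; apply: withinU_continuous.
- apply: closedI; first exact: closed_cube.
  by apply: preimage_closed => [x _|]; [exact: pc|exact: closed_le].
- apply: closedI; first exact: closed_cube.
  by apply: preimage_closed => [x _|]; [exact: pc|exact: closed_ge].
- apply: (@subspace_eq_continuous _ _ _ (f \o stretch 0)).
    by move=> x /set_mem[_ x2]; rewrite /from_subspace /concat_fun ifT.
  apply: (@within_comp_cont _ _ _ (cube n.+1) (stretch 0) f);
    [|exact: stretch_continuous|exact: spheroid_continuous].
    move=> x [cx /= x2]; apply: stretch_cube => //.
    have /andP[x00 _] := cx 0; rewrite subr0 mulr_ge0//=.
    by rewrite -(@ler_pM2l _ 2)// mulfV// in x2.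
- apply: (@subspace_eq_continuous _ _ _ (g \o stretch 1)).
    move=> x /set_mem[cx /= x2]; rewrite /from_subspace /concat_fun; case: ifPn => // x2'.
    by rewrite (@concat_mid _ f g)//; apply/le_anti/andP.
  apply: (@within_comp_cont _ _ _ (cube n.+1) (stretch 1) g);
    [|exact: stretch_continuous|exact: spheroid_continuous].
    move=> x [cx /= x2]; apply: stretch_cube => //.
    have /andP[_ x1] := cx 0; rewrite subr_ge0 lerBlDr.
    rewrite -(@ler_pM2l _ 2)// mulfV// in x2; rewrite x2 /=.
    by rewrite -[1 + 1]/(2 : R) -[leRHS]mulr1 ler_pM2l.
Qed.

Lemma concat_boundary n (f g : spheroid n.+1) x :
  cube_boundary x -> concat_fun f g x = x0.
Proof.
move=> [cx [i xi]]; rewrite /concat_fun; have /andP[x00 x01] := cx 0.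
case: ifPn => [x2|]; last rewrite -ltNge => /ltW x2.
- apply: spheroid_boundary; split.
    apply: stretch_cube => //; rewrite subr0 mulr_ge0//=.
    by rewrite -(@ler_pM2l _ 2)// mulfV// in x2.
  exists i; rewrite mxE subr0; case: eqP => [i0|//]; left.
  case: xi => xi; first by rewrite xi mulr0.
  move: x2; rewrite -i0 xi leNgt invf_lt1//.
  by rewrite ltr1n.
- apply: spheroid_boundary; split.
    apply: stretch_cube => //; rewrite subr_ge0 lerBlDr.
    rewrite -(@ler_pM2l _ 2)// mulfV// in x2; rewrite x2 /=.
    by rewrite -[1 + 1]/(2 : R) -[leRHS]mulr1 ler_pM2l.
  exists i; rewrite mxE; case: eqP => [i0|//]; right.
  case: xi => xi; last by rewrite xi mulr1 -[2]/(1 + 1) addrK.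
  by move: x2; rewrite -i0 xi leNgt invr_gt0 ltr0n.
Qed.

(* Concatenation along the first coordinate. *)
Definition concat n (f g : spheroid n.+1) : spheroid n.+1 :=
  Spheroid (@concat_continuous n f g) (@concat_boundary n f g).

(* The group law of [pi_(n+1)(X, x0)].  The class does not depend on the
   representatives; commutative for n >= 1. *)
Definition pi_mul n (a b : pi_ n.+1) : pi_ n.+1 :=
  class_of (concat (representative a) (representative b)).

(* [pi_(n+1)(X, x0) (x) Q] *)
Definition pi_tensorQ (n : nat) : lmodType rat := tensorQ (@pi_mul n).

End HomotopyGroups.

Arguments cube : clear implicits.

Section RationalHomotopyTheory.
Context (R : realType) (X : topologicalType).

Definition path_connected : Prop :=
  forall x y : X, exists2 p : R -> X, {within `[0, 1], continuous p} &
    p 0 = x /\ p 1 = y.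

Definition simply_connected : Prop :=
  [/\ exists x : X, True, path_connected &
      forall (x0 : X) (a b : pi_ R x0 1), a = b].

(* [pi_*(X) (x) Q], the sum of the [pi_i(X) (x) Q] for i >= 2 *)
Definition total_homotopy (x0 : X) : lmodType rat :=
  dsum (fun i => pi_tensorQ R x0 i.+1).

(* [H_*(X; Q)] *)
Definition total_homology : lmodType rat := dsum (homology R X).

(* The choice of base point is immaterial when [X] is simply connected. *)
Definition rationally_elliptic (x0 : X) : Prop :=
  [/\ simply_connected, finite_dim (total_homotopy x0) &
      finite_dim total_homology].

(* The polynomial [\sum_k d_k t^k] for a finitely supported sequence [d]. *)
Definition generating_poly (d : nat -> nat) : {poly R} :=
  \poly_(k < xget 0%N [set N | forall k, (N <= k)%N -> d k = 0%N]) (d k)%:R.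

Definition homological_poincare : {poly R} :=
  generating_poly (fun k => dim (homology R X k)).

Definition homotopical_poincare (x0 : X) : {poly R} :=
  generating_poly (fun k => if k is n.+2 then dim (pi_tensorQ R x0 n.+1) else 0%N).

End RationalHomotopyTheory.

Section Lambert.
Context {R : realType}.

(* On the reals [w * exp w] is not injective, and its inverse has two branches
   over [-1/e, 0[.  [lambertW] is the lower one, with values in ]-oo, -1].
   Substituting w = - r * ln p turns [r * c = p ^ r] into
   [w * exp w = - ln p / c], so for p > 1 the larger [r] is the smaller [w]. *)
Definition w_exp_w (w : R) : R := w * expR w.

Definition lambertW_dom : set R := w_exp_w @` `]-oo, -1].

(* Meaningful on [lambertW_dom] only. *)
Definition lambertW : R -> R := pinv (`]-oo, -1]%classic : set R) w_exp_w.

(* The value of the implicit function, as a relation: no [r] qualifies when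
   [r * c = p ^ r] has no solution. *)
Definition larger_solution (c p r : R) : Prop :=
  r * c = p `^ r /\ forall s : R, s * c = p `^ s -> s <= r.

End Lambert.

(* Main.v *)
Require Import Defs.
From mathcomp Require Import all_boot all_order all_algebra.
From mathcomp Require Import all_classical all_reals all_analysis.
From mathcomp Require Import freeg ring lra.

Set Implicit Arguments.
Unset Strict Implicit.
Unset Printing Implicit Defensive.

Import Order.TTheory GRing.Theory Num.Theory.
Import numFieldNormedType.Exports.
Local Open Scope classical_set_scope.
Local Open Scope ring_scope.

(* Since [X] is nonempty, the augmentation shows that [H_0] is nonzero, and total
   finiteness makes [P_X] a genuine polynomial with nonnegative coefficients and
   constant term at least 1; being different from 1, it exceeds 1 at every t > 0.
   With L = ln P_X(t) > 0 and c = P^pi_X(t) >= 0, the substitution w = - r L turns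
   r c = e^(r L) into w e^w = - L / c.  As w e^w has its minimum at -1 and is
   injective on ]-oo, -1], where it takes all values in [-1/e, 0[, the smallest w,
   i.e. the largest r, is given by the lower branch of W. *)

(** * The lower branch of W and the equation r c = p^r *)

Section LambertSolution.
Context {R : realType}.
Implicit Types a b c p r s w z y : R.

(** As e^(b-a) > 1 + (b-a) and b <= -1, one gets b e^(b-a) < b + b(b-a) <= b - (b-a) = a; multiply
    by e^a. *)
Lemma w_exp_w_lower_lt a b : a < b -> b <= -1 -> w_exp_w b < w_exp_w a.
Proof.
move=> ab b1; rewrite /w_exp_w.
have eab : 1 + (b - a) < expR (b - a) by rewrite expR_gt1Dx// subr_eq0 gt_eqF.
have -> : expR b = expR (b - a) * expR a by rewrite -expRD subrK.
rewrite mulrA ltr_pM2r ?expR_gt0//; nra.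
Qed.

Lemma w_exp_w_lower_inj : {in (`]-oo, -1]%classic : set R) &, injective w_exp_w}.
Proof.
move=> a b /set_mem; rewrite /= in_itv /= => a1 /set_mem; rewrite /= in_itv /= => b1 ab.
case: (ltgtP a b) => // h.
- by have := w_exp_w_lower_lt h b1; rewrite ab ltxx.
- by have := w_exp_w_lower_lt h a1; rewrite ab ltxx.
Qed.

(** The tangent bound e^(-(w+1)) >= 1 - (w+1) = -w, multiplied by -e^w. *)
Lemma w_exp_w_ge_min w : w_exp_w (-1) <= w_exp_w w.
Proof.
rewrite /w_exp_w; have -> : expR (-1) = expR (- (w + 1)) * expR w :> R.
  by rewrite -expRD; congr expR; ring.
rewrite mulrA ler_pM2r ?expR_gt0//.
have := expR_ge1Dx (- (w + 1)); lra.
Qed.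

Lemma w_exp_w_ge_near0 y : 0 < y -> exists2 w, w <= -1 & - y <= w_exp_w w.
Proof.
(* With [w = - B], [exp B >= (B / 2) ^ 2] gives [B * exp (- B) <= 4 / B <= y]. *)
move=> y0; pose B := 1 + 4 / y; have y40 : 0 < 4 / y by rewrite divr_gt0.
exists (- B); first by rewrite /B; lra.
have B0 : 0 < B by rewrite /B; lra.
rewrite /w_exp_w mulNr lerN2 expRN -/(B / _) ler_pdivrMr ?expR_gt0//.
have -> : expR B = expR (B / 2) ^+ 2 by rewrite expr2 -expRD; congr expR; field.
have eB : B / 2 < expR (B / 2) by have := expR_ge1Dx (B / 2); lra.
have {}eB : (B / 2) ^+ 2 <= expR (B / 2) ^+ 2.
  by rewrite lerXn2r ?nnegrE ?expR_ge0 ?ltW// divr_gt0.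
have yB : 4 <= y * B by rewrite /B mulrDr mulrCA mulfV ?gt_eqF//; lra.
apply: le_trans (_ : y * (B / 2) ^+ 2 <= _); last by rewrite ler_pM2l.
have -> : y * (B / 2) ^+ 2 = y * B * B / 4 by field.
nra.
Qed.

Lemma continuous_w_exp_w : continuous (@w_exp_w R).
Proof. by move=> x; apply: cvgM; [exact: cvg_id|exact: continuous_expR]. Qed.

Lemma w_exp_w_lambertW_dom w : w < 0 -> lambertW_dom (w_exp_w w).
Proof.
move=> w0; have z0 : 0 < - w_exp_w w by rewrite oppr_gt0 /w_exp_w nmulr_rlt0 ?expR_gt0.
have [a a1 za] := w_exp_w_ge_near0 z0; rewrite opprK in za.
have cont : {within `[a, -1], continuous (@w_exp_w R)}.
  exact/continuous_subspaceT/continuous_w_exp_w.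
(* On [a, -1] the value at [a] is at least the target, while the value at -1 is the global
   minimum. *)
have [|v] := IVT a1 cont (v := w_exp_w w).
  by rewrite ge_min w_exp_w_ge_min orbT le_max za.
by rewrite in_itv /= => /andP[_ v1] vE; exists v => //=; rewrite in_itv.
Qed.

Lemma lambertW_domP z : lambertW_dom z ->
  lambertW z <= -1 /\ w_exp_w (lambertW z) = z.
Proof.
by move=> [w w1 <-]; rewrite /lambertW pinvKV ?inE//; last exact: w_exp_w_lower_inj.
Qed.

Lemma lambertWK w : w <= -1 -> lambertW (w_exp_w w) = w.
Proof.
move=> w1; apply: pinvKV; first exact: w_exp_w_lower_inj.
by rewrite inE /= in_itv.
Qed.

(** W returns the smallest preimage: it inverts exactly for w <= -1, and its values never exceed -1
    < w otherwise. *)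
Lemma lambertW_le w : lambertW_dom (w_exp_w w) -> lambertW (w_exp_w w) <= w.
Proof.
move=> /lambertW_domP[W1 _]; have [/lambertWK->//|/ltW] := leP w (-1).
exact: le_trans.
Qed.

(** With L = ln p and E = p^s = e^(sL), the right side says sL/E = L/c, which is s c = E multiplied
    by L/(E c). *)
Lemma powR_linear_eqP c p s : 1 < p -> 0 < c ->
  s * c = p `^ s <-> w_exp_w (- (s * ln p)) = - (ln p / c).
Proof.
move=> p1 c0; have L0 := ln_gt0 p1; have E0 := expR_gt0 (s * ln p).
rewrite /powR gt_eqF ?(lt_trans ltr01)// /w_exp_w expRN.
set E := expR _ in E0 *; set L := ln p in L0 *.
split=> [scE|].
  have s0 : s != 0 by apply: contraTneq E0 => s0; rewrite -scE s0 mul0r ltxx.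
  by rewrite -scE; field; rewrite s0 gt_eqF.
rewrite mulNr => /oppr_inj sLE; apply: (mulfI (x := L / (E * c))).
  by rewrite mulf_neq0 ?invr_eq0 ?mulf_neq0// gt_eqF.
transitivity (s * L / E); first by field; rewrite !gt_eqF.
by rewrite sLE; field; rewrite !gt_eqF.
Qed.

Lemma larger_solution_lambertW c p r : 1 < p -> 0 <= c ->
  larger_solution c p r <->
  lambertW_dom (- (ln p / c)) /\ r = - (1 / ln p) * lambertW (- (ln p / c)).
Proof.
move=> p1; have L0 := ln_gt0 p1; rewrite le_eqVlt => /predU1P[<-|c0].
  (* Here [ln p / c] is 0 by convention, and 0 is not on the lower branch. *)
  split=> [[+ _]|[[w + wE] _]].
    by rewrite mulr0 => /esym/eqP; rewrite gt_eqF// powR_gt0// (lt_trans ltr01).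
  rewrite /= in_itv /= => w1; move/eqP: wE; rewrite invr0 mulr0 oppr0.
  by rewrite mulf_eq0 (gt_eqF (expR_gt0 _)) orbF lt_eqF// (le_lt_trans w1)// oppr_lt0.
have solP s := powR_linear_eqP s p1 c0.
set z := - (ln p / c) in solP *.
have z0 : z < 0 by rewrite oppr_lt0 divr_gt0.
(* Any solution u gives a preimage -(u ln p) of z, bounded below by W(z); dividing by -ln p < 0
   reverses the order. *)
have lower s : lambertW_dom z -> - (s * ln p) = lambertW z ->
    larger_solution c p s.
  move=> zdom sW; have [_ zW] := lambertW_domP zdom.
  split; first by apply/solP; rewrite sW.
  move=> u /solP uz; rewrite -(ler_pM2r L0) -lerN2 sW -uz.
  by apply: lambertW_le; rewrite uz.
have rE s : s = - (1 / ln p) * lambertW z <-> - (s * ln p) = lambertW z.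
  split=> [->|<-]; field; exact: lt0r_neq0.
rewrite rE; split=> [[req rmax]|[zdom rW]]; last exact: lower.
(* Since z < 0, the preimage -(r ln p) is negative, and values at negative points are attained on
   the lower branch. *)
have zdom : lambertW_dom z.
  move/solP: req => /[dup] rz <-; apply: w_exp_w_lambertW_dom.
  by rewrite -(pmulr_llt0 _ (expR_gt0 (- (r * ln p)))) -/(w_exp_w _) rz.
(* The candidate built from W is also a largest solution, so it equals r. *)
split=> //; have [sol smax] := lower (- (1 / ln p) * lambertW z) zdom (proj1 (rE _) erefl).
by apply/rE/le_anti; rewrite smax//= rmax.
Qed.

End LambertSolution.

(** * Finite dimension and direct sums *)

Section FiniteDimension.
Context {F : fieldType}.

Lemma finite_dim_span (V : lmodType F) n (b : 'I_n -> V) :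
  (forall v : V, exists a : 'I_n -> F, v = \sum_i a i *: b i) -> finite_dim V.
Proof.
elim: n b => [|n IH] b gen; first by exists 0%N, b; split=> // a _ [].
have [indep|] := pselect (forall a : 'I_n.+1 -> F,
    \sum_i a i *: b i = 0 -> forall i, a i = 0); first by exists n.+1, b.
move=> /existsNP[a] /not_implyP[rel] /existsNP[i] /eqP ai0.
apply: (IH (fun j => b (fintype.lift i j))) => v; have [c ->] := gen v.
have bi : b i = \sum_j - ((a i)^-1 * a (fintype.lift i j)) *: b (fintype.lift i j).
  move: rel; rewrite (bigD1_ord i)//= => /eqP; rewrite addr_eq0 => /eqP rel.
  rewrite -[LHS]scale1r -(mulVf ai0) -scalerA rel scalerN -scaleNr scaler_sumr.
  by apply: eq_bigr => j _; rewrite scalerA mulNr.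
exists (fun j => c (fintype.lift i j) - c i * ((a i)^-1 * a (fintype.lift i j))).
rewrite (bigD1_ord i)//= bi scaler_sumr -big_split; apply: eq_bigr => j _ /=.
by rewrite scalerA -scalerDl mulrN addrC.
Qed.

Lemma dim_basis (V : lmodType F) :
  finite_dim V -> exists b : 'I_(Defs.dim V) -> V, is_basis b.
Proof. exact: xgetPex. Qed.

(** Finiteness rules out the default value 0 of [dim]; an empty basis would then make every vector
    an empty sum. *)
Lemma dim_gt0 (V : lmodType F) (v : V) : finite_dim V -> v != 0 -> (0 < Defs.dim V)%N.
Proof.
move=> /dim_basis[b [gen _]]; apply: contraNT; rewrite -eqn0Ngt => /eqP dim0.
have [a ->] := gen v; rewrite big1// => i _.
by have := ltn_ord i; rewrite [X in (_ < X)%N]dim0.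
Qed.

Lemma dim_trivial (V : lmodType F) : (forall v : V, v = 0) -> Defs.dim V = 0%N.
Proof.
move=> V0; rewrite /Defs.dim; case: xgetP => // -[//|n] _ [b [_ indep]].
have := indep (fun=> 1) (V0 _) ord0 => /eqP; by rewrite oner_eq0.
Qed.

End FiniteDimension.

Section DirectSumDimension.
Context {F : fieldType} (V : nat -> lmodType F).

Lemma dsum_val_sum n (a : 'I_n -> F) (b : 'I_n -> dsum V) k :
  dsum_val (\sum_i a i *: b i) k = \sum_i a i *: dsum_val (b i) k.
Proof.
by elim/big_rec2 : _ => [|i v u _ <-].
Qed.

Lemma dsum_inj_subproof k (v : V k) :
  (dfwith (fun=> 0) k v : dprod V) \in @fin_supp F V.
Proof.
apply/asboolP; exists k.+1 => i ki; rewrite dfwithout//.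
by rewrite neq_ltn ki.
Qed.

Definition dsum_inj k (v : V k) : dsum V := DSum (dsum_inj_subproof v).

Lemma dsum_injK k (v : V k) : dsum_val (dsum_inj v) k = v.
Proof. exact: dfwithin. Qed.

Lemma finite_dim_dsum_component k : finite_dim (dsum V) -> finite_dim (V k).
Proof.
move=> [n [b [gen _]]]; apply: (@finite_dim_span _ _ n (fun i => dsum_val (b i) k)).
move=> v; have [a va] := gen (dsum_inj v); exists a.
by rewrite -dsum_val_sum -va dsum_injK.
Qed.

(** Finitely many generators, each of finite support, all vanish beyond a common index. *)
Lemma finite_dim_dsum_bounded : finite_dim (dsum V) ->
  exists N, forall k, (N <= k)%N -> Defs.dim (V k) = 0%N.
Proof.
move=> [n [b [gen _]]].
have /choice[N bN] : forall i, exists N, forall k, (N <= k)%N -> dsum_val (b i) k = 0.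
  by move=> i; exact/asboolP/(valP (b i)).
exists (\max_i N i)%N => k Nk; apply: dim_trivial => v.
have [a va] := gen (dsum_inj v); rewrite -[v]dsum_injK va dsum_val_sum big1// => i _.
by rewrite bN ?scaler0// (leq_trans _ Nk)// leq_bigmax.
Qed.

End DirectSumDimension.

(** * Nonvanishing of rational H_0 *)

Section Quotient.
Context {F : fieldType} (V : lmodType F) (A : set V).

Lemma quotmod_pi_eq0 (v : V) : quotmod_pi A v = 0 -> v \in span_of A.
Proof.
move=> v0; rewrite -[v]subr0 ring_quotient.Quotient.idealrBE.
apply/eqP; rewrite -[LHS]/(quotmod_pi A v) v0.
by symmetry; exact: raddf0.
Qed.

(** The kernel of f is a subspace containing A, hence contains its span. *)
Lemma span_of_ker (W : lmodType F) (f : V -> W) (v : V) :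
  linear f -> (forall u, A u -> f u = 0) -> v \in span_of A -> f v = 0.
Proof.
move=> flin fA /asboolP/(_ [pred u | f u == 0]) vker; apply/eqP; apply: vker.
  split; first by have := flin (-1) 0 0; rewrite scaler0 addr0 scaleN1r addNr inE => ->.
  by move=> a u w; rewrite !inE flin => /eqP-> /eqP->; rewrite scaler0 addr0.
by move=> u /fA fu; rewrite inE fu.
Qed.

End Quotient.

Section Augmentation.
Context (R : realType) (X : topologicalType).

Definition augmentation (n : nat) (c : chain R X n) : rat^o :=
  fglift (fun=> 1 : rat^o) c.

(** The two faces of a 1-simplex carry opposite signs. *)
Lemma augmentation_boundary (c : chain R X 1) : augmentation (boundary c) = 0.
Proof.
rewrite /augmentation /= -[c]freeg_sumE !raddf_sum big1// => s _ /=.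
rewrite liftU linearZ /= /boundary_simplex !big_ord_recl big_ord0 addr0.
rewrite linearD /= !linearZ /= !liftU.
by rewrite expr0 expr1 !scale1r scaleN1r subrr scaler0.
Qed.

(** The 0-simplex at x has augmentation 1, whereas boundaries have augmentation 0. *)
Lemma homology0_neq0 (x : X) : exists h : homology R X 0, h != 0.
Proof.
pose s : continuousType (simplex R 0) X := mkcts (@cst_continuous _ _ x).
have sZ : << s >> \in @cycles R X 0 by rewrite inE.
exists (quotmod_pi _ (Cycle sZ)); apply/eqP => /quotmod_pi_eq0.
move=> /(span_of_ker (f := fun z : Defs.cycle R X 0 => augmentation (cycle_val z))).
rewrite /augmentation /= liftU scale1r => s0.
suff : 1 = 0 :> rat by move/eqP; rewrite oner_eq0.
apply: s0 => [a u v|z [c ->]]; last exact: augmentation_boundary.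
by rewrite -linearP.
Qed.

End Augmentation.

(** * Polynomials with nonnegative coefficients *)

Section PositivePolynomials.
Context {R : numDomainType}.

Lemma horner_ge0 (p : {poly R}) (t : R) :
  (forall k, 0 <= p`_k) -> 0 <= t -> 0 <= p.[t].
Proof.
by move=> p0 t0; rewrite horner_coef sumr_ge0// => i _; rewrite mulr_ge0 ?exprn_ge0.
Qed.

(** The leading term is positive at t, the other terms nonnegative. *)
Lemma horner_gt0 (p : {poly R}) (t : R) :
  p != 0 -> (forall k, 0 <= p`_k) -> 0 < t -> 0 < p.[t].
Proof.
move=> pn0 p0 t0; have sz : (0 < size p)%N by rewrite size_poly_gt0.
have szp : ((size p).-1 < size p)%N by rewrite prednK.
rewrite horner_coef (bigD1 (Ordinal szp))//= ltr_pwDl//.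
  by rewrite mulr_gt0 ?exprn_gt0// lt0r p0 -lead_coefE lead_coef_eq0 pn0.
by rewrite sumr_ge0// => i _; rewrite mulr_ge0 ?exprn_ge0// ltW.
Qed.

End PositivePolynomials.

Section GeneratingPoly.
Context {R : realType}.

Lemma generating_poly_ge0 (d : nat -> nat) k : 0 <= (generating_poly R d)`_k.
Proof. by rewrite coef_poly; case: ifP. Qed.

(** Eventual vanishing makes the chosen truncation bound genuine, so no nonzero term is cut off. *)
Lemma coef_generating_poly (d : nat -> nat) k :
  (exists N, forall k, (N <= k)%N -> d k = 0%N) ->
  (generating_poly R d)`_k = (d k)%:R.
Proof.
by move=> /(xgetPex 0%N) dN; rewrite coef_poly; case: ltnP => // /dN ->.
Qed.

(** Subtracting 1 keeps all coefficients nonnegative because d 0 >= 1, and leaves a nonzero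
    polynomial. *)
Lemma generating_poly_gt1 (d : nat -> nat) (t : R) :
  (exists N, forall k, (N <= k)%N -> d k = 0%N) -> (0 < d 0)%N ->
  generating_poly R d != 1 -> 0 < t -> 1 < (generating_poly R d).[t].
Proof.
move=> dN d0 P1 t0; rewrite -subr_gt0 -[X in _ - X](hornerC 1 t) -hornerN -hornerD.
apply: horner_gt0 => //; first by rewrite subr_eq0.
move=> k; rewrite coefB coef_generating_poly// coefC.
by case: k => [|k] /=; rewrite ?subr0// subr_ge0 ler1n.
Qed.

End GeneratingPoly.

(** * Bounds for the two Poincaré polynomials *)

Section PoincarePolynomials.
Context {R : realType} {X : topologicalType} {x0 : X}.

Lemma homological_poincare_gt1 (t : R) : rationally_elliptic R x0 ->
  homological_poincare R X <> 1 -> 0 < t -> 1 < (homological_poincare R X).[t].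
Proof.
move=> [_ _ finH] /eqP P1; apply: generating_poly_gt1 => //.
  exact: finite_dim_dsum_bounded.
have [h] := homology0_neq0 R x0; apply: dim_gt0.
exact: finite_dim_dsum_component finH.
Qed.

Lemma homotopical_poincare_ge0 (t : R) : 0 <= t ->
  0 <= (homotopical_poincare R x0).[t].
Proof. by apply: horner_ge0 => k; exact: generating_poly_ge0. Qed.

End PoincarePolynomials.

Theorem mainTheorem2 (R : realType) (X : topologicalType) (x0 : X) (eps : R)
    (X_elliptic : rationally_elliptic R x0)
    (P_neq1 : homological_poincare R X <> 1)
    (eps_gt0 : 0 < eps) :
  forall t : R, eps <= t ->
  let P := (homological_poincare R X).[t] in
  let Ppi := (homotopical_poincare R x0).[t] in
  forall r : R,
    larger_solution Ppi P r <->
    lambertW_dom (- (ln P / Ppi)) /\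
    r = - (1 / ln P) * lambertW (- (ln P / Ppi)).
Proof.
move=> t eps_t P Ppi r; have t0 : 0 < t := lt_le_trans eps_gt0 eps_t.
apply: larger_solution_lambertW; last exact/homotopical_poincare_ge0/ltW.
exact: homological_poincare_gt1 X_elliptic P_neq1 t0.
Qed.
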